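(* Let $A$ be a unital uniform algebra acting on a compact Hausdorff space $K$, let $H$ be a complex Hilbert space, let $\gamma\colon A\to\mathscr{L}(H)$ be a unital bounded homomorphism, and let $\Phi\colon A\to A$ be a bounded antilinear map. If $\|\gamma\|>1$ and $(f_{0},x_{0})\in A\times H$ is an extremal pair for $\gamma$, then $$\|\gamma\|\leq\left(\frac{1}{2}\inf_{\omega\in A'}\|\gamma_{\Phi}-\omega\|\right)+\sqrt{\left(\frac{1}{2}\inf_{\omega\in A'}\|\gamma_{\Phi}-\omega\|\right)^{2}+\left|\langle\gamma(\Phi(f_{0})f_{0})x_{0},x_{0}\rangle\right|}.$$
   Context: A unital uniform algebra $A$ acting on a compact Hausdorff space $K$ is a closed unital subalgebra of $C(K)$, the algebra of continuous complex-valued functions on $K$ with the supremum norm $\|\cdot\|_{K}$. $\mathscr{L}(H)$ is the space of bounded linear operators on $H$ with the operator norm. A unital bounded homomorphism $\gamma\colon A\to\mathscr{L}(H)$ is a bounded linear multiplicative map with $\gamma(1)=1$ (the identity operator); $\|\gamma\|$ is its norm as a bounded linear map between the normed spaces $A$ and $\mathscr{L}(H)$. A pair $(f_{0},x_{0})\in A\times H$ is called an extremal pair for $\gamma$ if $\|f_{0}\|_{K}=1$, $\|x_{0}\|=1$ and $\|\gamma\|=\|\gamma(f_{0})x_{0}\|$. For a bounded antilinear (conjugate-linear) map $\Phi\colon A\to A$, the bounded linear map $\gamma_{\Phi}\colon A\to\mathscr{L}(H)$ is defined by $\gamma_{\Phi}(f):=\gamma(f)+\gamma(\Phi(f))^{*}$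 for all $f\in A$, where $^{*}$ is the Hilbert space adjoint. $A'$ is the dual space of bounded linear functionals on $A$, canonically embedded in the Banach space of bounded linear maps $A\to\mathscr{L}(H)$ by identifying $\omega\in A'$ with the map $f\mapsto\omega(f)\cdot 1$ (scalar multiples of the identity operator); $\|\gamma_{\Phi}-\omega\|$ is the norm in this Banach space. $\Phi(f_0)f_0$ is the pointwise product in $A$. *)

(* Defs.v *)
From HB Require Import structures.
From mathcomp Require Import all_boot all_order all_algebra sesquilinear.
From mathcomp Require Import complex.
From mathcomp Require Import boolp classical_sets functions filter reals.
From mathcomp Require Import topology normedtype.
From mathcomp Require Import ring lra.

Set Implicit Arguments.
Unset Strict Implicit.
Unset Printing Implicit Defensive.

Import Order.TTheory GRing.Theory Num.Theory.
Import numFieldNormedType.Exports.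

Local Open Scope classical_set_scope.
Local Open Scope ring_scope.
Local Open Scope complex_scope.

(* In a normed module over R[i], `|x| is an element of R[i] (with zero imaginary
   part); rnorm x is the same norm as a real number. *)
Definition rnorm (R : realType) (V : normedModType R[i]) (x : V) : R :=
  complex.Re `|x|.

Section RealNorm.
Context {R : realType}.

Lemma cabsE (a : R[i]) : `|a| = (complex.Re `|a|)%:C.
Proof. by rewrite RRe_real ?normr_real. Qed.

Lemma cabs_ge0 (a : R[i]) : 0 <= complex.Re `|a|.
Proof. by have := normr_ge0 a; rewrite cabsE lecR. Qed.

Lemma cabs_gt0 (a : R[i]) : a != 0 -> 0 < complex.Re `|a|.
Proof. by rewrite -normr_gt0 cabsE ltcR. Qed.

Lemma cabsV (a : R[i]) : complex.Re `|a^-1| = (complex.Re `|a|)^-1.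
Proof.
by apply: complexI; rewrite -cabsE normfV cabsE fmorphV.
Qed.

Section one.
Variable V : normedModType R[i].
Implicit Types x y : V.

Lemma rnormE x : `|x| = (rnorm x)%:C.
Proof.
have := normr_ge0 x; rewrite /rnorm lecE /=; case: (`|x|) => a b /=.
by case/andP => /eqP ->.
Qed.

Lemma rnorm_ge0 x : 0 <= rnorm x.
Proof. by have := normr_ge0 x; rewrite rnormE lecR. Qed.

Lemma rnormD x y : rnorm (x + y) <= rnorm x + rnorm y.
Proof. by have := ler_normD x y; rewrite !rnormE -rmorphD lecR. Qed.

Lemma rnormZ (a : R[i]) x : rnorm (a *: x) = complex.Re `|a| * rnorm x.
Proof.
by have := normrZ a x; rewrite !rnormE cabsE -rmorphM => /complexI.
Qed.

Lemma rnorm0 : rnorm (0 : V) = 0.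
Proof. by rewrite /rnorm normr0. Qed.

Lemma rnorm_eq0 x : rnorm x = 0 -> x = 0.
Proof. by move=> h; apply/normr0_eq0; rewrite rnormE h. Qed.

Lemma rnormN x : rnorm (- x) = rnorm x.
Proof. by rewrite /rnorm normrN. Qed.

End one.
End RealNorm.

Section BoundedLinear.
Context {R : realType} (V W : normedModType R[i]).

Definition is_bounded (f : V -> W) :=
  exists M : R, forall x, rnorm (f x) <= M * rnorm x.

Definition bounded_linear_pred : {pred V -> W} :=
  fun f => `[< linear f /\ is_bounded f >].

Record bounded_linear := BoundedLinear {
  bl_fun :> V -> W ;
  bl_subproof : bl_fun \in bounded_linear_pred }.

HB.instance Definition _ := [isSub for bl_fun].
HB.instance Definition _ := [Choice of bounded_linear by <:].

Lemma bounded_linear_predP (f : V -> W) :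
  f \in bounded_linear_pred <-> linear f /\ is_bounded f.
Proof. by split=> [/asboolP|h]//; apply/asboolP. Qed.

Lemma bounded_linear_submod : submod_closed bounded_linear_pred.
Proof.
split.
  apply/bounded_linear_predP; split=> [a x y|]; first by rewrite /= scaler0 addr0.
  by exists 0 => x; rewrite mul0r rnorm0.
move=> a f g /bounded_linear_predP[fl [M fM]] /bounded_linear_predP[gl [N gN]].
apply/bounded_linear_predP; split=> [b x y|].
  rewrite !fctE fl gl !scalerDr !scalerA [b * a]mulrC.
  by rewrite addrACA.
exists (complex.Re `|a| * M + N) => x; rewrite !fctE (le_trans (rnormD _ _))//.
rewrite mulrDl lerD// rnormZ -mulrA ler_wpM2l//.
exact: cabs_ge0.
Qed.

HB.instance Definition _ :=
  GRing.isSubmodClosed.Build _ _ bounded_linear_pred bounded_linear_submod.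
HB.instance Definition _ := [SubChoice_isSubLmodule of bounded_linear by <:].

End BoundedLinear.

(* Meaningful for bounded linear f only; it is the norm of the normed module
   bounded_linear V W below (rnorm_opnorm). *)
Definition opnorm (R : realType) (V W : normedModType R[i]) (f : V -> W) : R :=
  sup [set rnorm (f x) | x in [set x : V | rnorm x <= 1]].

Section OperatorNorm.
Context {R : realType} {V W : normedModType R[i]}.
Implicit Types f g : bounded_linear V W.

Lemma bl_linear f : linear f.
Proof. by have /bounded_linear_predP[] := bl_subproof f. Qed.

Lemma bl_bounded f : is_bounded f.
Proof. by have /bounded_linear_predP[] := bl_subproof f. Qed.

HB.instance Definition _ f := GRing.isLinear.Build _ _ _ _ (bl_fun f) (bl_linear f).

Lemma blDE f g x : (f + g) x = f x + g x. Proof. by []. Qed.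
Lemma blZE a f x : (a *: f) x = a *: f x. Proof. by []. Qed.

Lemma opnorm_has_sup f :
  has_sup [set rnorm (f x) | x in [set x : V | rnorm x <= 1]].
Proof.
split; first by exists (rnorm (f 0)), 0 => //=; rewrite rnorm0.
have [M fM] := bl_bounded f.
exists `|M| => _ [x /= x1 <-]; apply: (le_trans (fM x)).
rewrite (le_trans (ler_wpM2r (rnorm_ge0 x) (ler_norm M)))//.
by rewrite -[leRHS]mulr1 ler_wpM2l.
Qed.

Lemma opnorm_ge0 f : 0 <= opnorm f.
Proof.
rewrite (le_trans (rnorm_ge0 (f 0)))//.
by apply: (sup_upper_bound (opnorm_has_sup f)); exists 0; rewrite //= rnorm0.
Qed.

Lemma opnormP f x : rnorm (f x) <= opnorm f * rnorm x.
Proof.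
have [->|x0] := eqVneq x 0; first by rewrite linear0 !rnorm0 mulr0.
have nx0 : 0 < rnorm x.
  by rewrite lt_neqAle rnorm_ge0 andbT eq_sym; apply: contra_neq x0 => /rnorm_eq0.
have nV : complex.Re `|((rnorm x)^-1)%:C| = (rnorm x)^-1.
  by rewrite ger0_norm// lecR invr_ge0 ltW.
rewrite -ler_pdivrMr// mulrC -nV -rnormZ -linearZ.
apply: (sup_upper_bound (opnorm_has_sup f)) => /=.
exists ((rnorm x)^-1%:C *: x) => //.
by rewrite /= rnormZ nV mulVf// gt_eqF.
Qed.

Lemma opnorm_le f M : 0 <= M -> (forall x, rnorm (f x) <= M * rnorm x) ->
  opnorm f <= M.
Proof.
move=> M0 fM; apply: ge_sup; first by case: (opnorm_has_sup f).
move=> _ [x /= x1 <-]; apply: (le_trans (fM x)).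
by rewrite -[leRHS]mulr1 ler_wpM2l.
Qed.

Let nrm f : R[i] := (opnorm f)%:C.

Let nrmD f g : nrm (f + g) <= nrm f + nrm g.
Proof.
rewrite /nrm -rmorphD lecR opnorm_le ?addr_ge0 ?opnorm_ge0// => x.
by rewrite blDE (le_trans (rnormD _ _))// mulrDl lerD ?opnormP.
Qed.

Let opnormZ_le a f : opnorm (a *: f) <= complex.Re `|a| * opnorm f.
Proof.
rewrite opnorm_le ?mulr_ge0 ?cabs_ge0 ?opnorm_ge0// => x.
by rewrite blZE rnormZ -mulrA ler_wpM2l ?cabs_ge0 ?opnormP.
Qed.

Let nrmZ a f : nrm (a *: f) = `|a| * nrm f.
Proof.
rewrite /nrm cabsE -rmorphM; congr _%:C; apply/eqP.
rewrite eq_le opnormZ_le andTb.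
have [->|a0] := eqVneq a 0; first by rewrite normr0 mul0r opnorm_ge0.
rewrite -ler_pdivlMl ?cabs_gt0// -cabsV.
by have := opnormZ_le a^-1 (a *: f); rewrite scalerA mulVf// scale1r.
Qed.

Let nrm_eq0 f : nrm f = 0 -> f = 0.
Proof.
move=> /complexI f0; apply/val_inj/funext => x /=; apply/rnorm_eq0/eqP.
by rewrite eq_le rnorm_ge0 andbT (le_trans (opnormP f x))// f0 mul0r.
Qed.

HB.instance Definition _ :=
  @Lmodule_isNormed.Build R[i] (bounded_linear V W) nrm nrmD nrmZ nrm_eq0.

Lemma rnorm_opnorm f : rnorm f = opnorm f.
Proof. by []. Qed.

End OperatorNorm.

Section BoundedOperators.
Context {R : realType} {H : normedModType R[i]}.
Implicit Types S T U : bounded_linear H H.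

Lemma bl_id_subproof : (idfun : H -> H) \in bounded_linear_pred (V := H) (W := H).
Proof.
by apply/bounded_linear_predP; split=> //; exists 1 => x; rewrite mul1r.
Qed.

Lemma bl_comp_subproof S T : (S \o T) \in bounded_linear_pred (V := H) (W := H).
Proof.
apply/bounded_linear_predP; split=> [a x y|]; first by rewrite /= !linearP.
exists (opnorm S * opnorm T) => x /=.
by rewrite (le_trans (opnormP _ _))// -mulrA ler_wpM2l ?opnorm_ge0 ?opnormP.
Qed.

Definition bl_id := BoundedLinear bl_id_subproof.
Definition bl_comp S T := BoundedLinear (bl_comp_subproof S T).

Let bl_compA : associative bl_comp.
Proof. by move=> S T U; apply/val_inj. Qed.
Let bl_comp1l : left_id bl_id bl_comp.
Proof. by move=> S; apply/val_inj. Qed.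
Let bl_comp1r : right_id bl_id bl_comp.
Proof. by move=> S; apply/val_inj. Qed.
Let bl_compDl : left_distributive bl_comp +%R.
Proof. by move=> S T U; apply/val_inj. Qed.
Let bl_compDr : right_distributive bl_comp +%R.
Proof. by move=> S T U; apply/val_inj/funext => x; rewrite /= !fctE linearD. Qed.

(* The product of bounded operators is composition. *)
HB.instance Definition _ := GRing.Zmodule_isPzRing.Build (bounded_linear H H)
  bl_compA bl_comp1l bl_comp1r bl_compDl bl_compDr.

End BoundedOperators.

HB.mixin Record isCompactHausdorff K & Topological K := {
  compact_setT : compact [set: K];
  hausdorff_subproof : hausdorff_space K }.

#[short(type="compactHausdorffType")]
HB.structure Definition CompactHausdorff :=
  {K of Topological K & isCompactHausdorff K}.

Section ContinuousFunctions.
Context (R : realType) (K : compactHausdorffType).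

Definition continuous_pred : {pred K -> R[i]^o} := fun f => `[< continuous f >].

Record continuous_fun := ContinuousFunction {
  cfun :> K -> R[i]^o ;
  cfun_subproof : cfun \in continuous_pred }.

HB.instance Definition _ := [isSub for cfun].
HB.instance Definition _ := [Choice of continuous_fun by <:].

Lemma cfun_continuous (f : continuous_fun) : continuous f.
Proof. by have /asboolP := cfun_subproof f. Qed.

Lemma continuous_submod : submod_closed continuous_pred.
Proof.
split; first by apply/asboolP => x; exact: cst_continuous.
move=> a f g /asboolP fc /asboolP gc; apply/asboolP => x.
by apply: cvgD; [apply: cvgZr; exact: fc|exact: gc].
Qed.

Lemma continuous_subring : subring_closed continuous_pred.
Proof.
split; first by apply/asboolP => x; exact: cst_continuous.
- by move=> f g /asboolP fc /asboolP gc; apply/asboolP => x;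
     apply: cvgB; [exact: fc|exact: gc].
- by move=> f g /asboolP fc /asboolP gc; apply/asboolP => x;
     apply: cvgM; [exact: fc|exact: gc].
Qed.

HB.instance Definition _ :=
  GRing.isSubmodClosed.Build _ _ continuous_pred continuous_submod.
HB.instance Definition _ :=
  GRing.isSubringClosed.Build _ continuous_pred continuous_subring.
HB.instance Definition _ := GRing.SubChoice_isSubComPzRing.Build _ _ continuous_fun
  (subringClosedP _).
HB.instance Definition _ := [SubZmodule_isSubLmodule of continuous_fun by <:].

(* For empty K the set is empty and its sup is 0 by convention. *)
Definition supnorm (f : K -> R[i]^o) : R := sup [set rnorm (f t) | t in [set: K]].

Implicit Types f g : continuous_fun.

Lemma supnorm_has_ubound f : has_ubound [set rnorm (f t) | t in [set: K]].
Proof.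
have cg : continuous (fun t => rnorm (f t) : R^o).
  move=> t; apply/cvgrPdist_lt => e e0.
  have e0' : 0 < e%:C by rewrite ltcR.
  have /cvgrPdist_lt/(_ _ e0') := @cfun_continuous f t.
  apply: filterS => s; rewrite -ltcR; apply: le_lt_trans.
  have := ler_dist_dist (f t) (f s).
  by rewrite [`|f t|]rnormE [`|f s|]rnormE -rmorphB normc_def/= expr0n/= addr0 sqrtr_sqr.
have := continuous_compact (continuous_subspaceT cg) compact_setT.
move=> /compact_bounded[M [_ /(_ (M + 1))]]; rewrite ltrDl ltr01 => /(_ isT) HM.
exists (M + 1) => _ [t _ <-]; rewrite (le_trans (ler_norm _))//.
by apply: HM; exists t.
Qed.

Lemma supnormP f t : rnorm (f t) <= supnorm f.
Proof. by apply: (ub_le_sup (supnorm_has_ubound f)); exists t. Qed.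

Lemma supnorm_le f M : 0 <= M -> (forall t, rnorm (f t) <= M) -> supnorm f <= M.
Proof.
move=> M0 fM; have [[t _]|/nonemptyPn K0] := pselect ([set: K] !=set0).
  by apply: ge_sup => [|_ [s _ <-]//]; exists (rnorm (f t)), t.
by rewrite /supnorm K0 image_set0 sup0.
Qed.

Lemma supnorm_ge0 f : 0 <= supnorm f.
Proof.
have [[t _]|/nonemptyPn K0] := pselect ([set: K] !=set0).
  exact: le_trans (rnorm_ge0 (f t)) (supnormP f t).
by rewrite /supnorm K0 image_set0 sup0.
Qed.

Let nrm f : R[i] := (supnorm f)%:C.

Let nrmD f g : nrm (f + g) <= nrm f + nrm g.
Proof.
rewrite /nrm -rmorphD lecR supnorm_le ?addr_ge0 ?supnorm_ge0// => x.
by rewrite (le_trans (rnormD _ _))// lerD ?supnormP.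
Qed.

Let supnormZ_le a f : supnorm (a *: f) <= complex.Re `|a| * supnorm f.
Proof.
rewrite supnorm_le ?mulr_ge0 ?cabs_ge0 ?supnorm_ge0// => x.
by rewrite [rnorm _]rnormZ ler_wpM2l ?cabs_ge0 ?supnormP.
Qed.

Let nrmZ a f : nrm (a *: f) = `|a| * nrm f.
Proof.
rewrite /nrm cabsE -rmorphM; congr _%:C; apply/eqP.
rewrite eq_le supnormZ_le andTb.
have [->|a0] := eqVneq a 0; first by rewrite normr0 mul0r supnorm_ge0.
rewrite -ler_pdivlMl ?cabs_gt0// -cabsV.
by have := supnormZ_le a^-1 (a *: f); rewrite scalerA mulVf// scale1r.
Qed.

Let nrm_eq0 f : nrm f = 0 -> f = 0.
Proof.
move=> /complexI f0; apply/val_inj/funext => x /=; apply/rnorm_eq0/eqP.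
by rewrite eq_le rnorm_ge0 andbT (le_trans (supnormP f x))// f0.
Qed.

HB.instance Definition _ :=
  @Lmodule_isNormed.Build R[i] continuous_fun nrm nrmD nrmZ nrm_eq0.

Lemma rnorm_supnorm f : rnorm f = supnorm f.
Proof. by []. Qed.

End ContinuousFunctions.

(* closed refers to the topology induced by the supremum norm.  Point separation
   is not part of the definition. *)
Record uniform_algebra (R : realType) (K : compactHausdorffType) :=
  UniformAlgebra {
    ua_pred :> {pred continuous_fun R K} ;
    ua_submod : submod_closed ua_pred ;
    ua_mulr : mulr_closed ua_pred ;
    ua_closed : closed [set f | f \in ua_pred] }.

Section UniformAlgebra.
Context {R : realType} {K : compactHausdorffType} (A : uniform_algebra R K).

Record ua_elt := UAElt {
  ua_val :> continuous_fun R K ;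
  ua_subproof : ua_val \in ua_pred A }.

HB.instance Definition _ := GRing.isSubmodClosed.Build _ _ (ua_pred A) (ua_submod A).
HB.instance Definition _ := GRing.isMulClosed.Build _ (ua_pred A) (ua_mulr A).

HB.instance Definition _ := [isSub for ua_val].
HB.instance Definition _ := [Choice of ua_elt by <:].
HB.instance Definition _ := GRing.SubChoice_isSubComPzRing.Build _ _ ua_elt
  (subringClosedP _).
HB.instance Definition _ := [SubZmodule_isSubLmodule of ua_elt by <:].

Implicit Types f g : ua_elt.

Let nrm f : R[i] := `|ua_val f|.
Let nrmD f g : nrm (f + g) <= nrm f + nrm g.
Proof. exact: ler_normD. Qed.
Let nrmZ a f : nrm (a *: f) = `|a| * nrm f.
Proof. exact: normrZ. Qed.
Let nrm_eq0 f : nrm f = 0 -> f = 0.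
Proof. by move=> /normr0_eq0 f0; exact/val_inj. Qed.

HB.instance Definition _ :=
  @Lmodule_isNormed.Build R[i] ua_elt nrm nrmD nrmZ nrm_eq0.

End UniformAlgebra.

(* As always for {dot H for conjC}, the inner product is linear in its first
   argument and conjugate-linear in the second one. *)
HB.mixin Record NormedModule_isHilbert (R : realType) H
    & CompleteNormedModule R[i] H := {
  inner : {dot H for (@Num.conj R[i])} ;
  inner_norm : forall x : H, inner x x = `|x| ^+ 2 }.

#[short(type="hilbertType")]
HB.structure Definition Hilbert (R : realType) :=
  {H of CompleteNormedModule R[i] H & NormedModule_isHilbert R H}.

Section InnerProduct.
Context {R : realType} {H : hilbertType R}.
Implicit Types x y z : H.

Lemma innerDl x y z : inner (x + y) z = inner x z + inner y z.
Proof. exact: linearDl. Qed.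

Lemma innerZl a x y : inner (a *: x) y = a * inner x y.
Proof. exact: linearZl_LR. Qed.

Lemma innerDr x y z : inner x (y + z) = inner x y + inner x z.
Proof. exact: linearDr. Qed.

Lemma innerZr a x y : inner x (a *: y) = a^* * inner x y.
Proof. exact: linearZr_LR. Qed.

Lemma innerC x y : inner x y = (inner y x)^*.
Proof. by rewrite hermitian_subproof expr0 mul1r. Qed.

Let rdot x y : R := complex.Re (inner x y).

Let rdotC x y : rdot x y = rdot y x.
Proof. by rewrite /rdot innerC; case: (inner y x). Qed.

Let rdotDl x y z : rdot (x + y) z = rdot x z + rdot y z.
Proof. by rewrite /rdot innerDl raddfD. Qed.

Let rdotZl t x y : rdot (t%:C *: x) y = t * rdot x y.
Proof. by rewrite /rdot innerZl; case: (inner x y) => a b /=; rewrite mul0r subr0. Qed.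

Let rdotDr x y z : rdot x (y + z) = rdot x y + rdot x z.
Proof. by rewrite !(rdotC x) rdotDl. Qed.

Let rdotZr t x y : rdot x (t%:C *: y) = t * rdot x y.
Proof. by rewrite !(rdotC x) rdotZl. Qed.

Let rdot_norm x : rdot x x = rnorm x ^+ 2.
Proof. by rewrite /rdot inner_norm rnormE -rmorphXn. Qed.

Let expand x y t :
  rnorm (x + t%:C *: y) ^+ 2 = rnorm x ^+ 2 + 2 * t * rdot x y + t ^+ 2 * rnorm y ^+ 2.
Proof.
rewrite -!rdot_norm rdotDl !rdotDr !rdotZl !rdotZr (rdotC y x); ring.
Qed.

Let rdot_le x y : `|rdot x y| <= rnorm x * rnorm y.
Proof.
have [->|y0] := eqVneq y 0.
  have := rdotZr 0 x 0; rewrite scaler0 mul0r => ->.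
  by rewrite normr0 mulr_ge0 ?rnorm_ge0.
have ny0 : 0 < rnorm y.
  by rewrite lt_neqAle rnorm_ge0 andbT eq_sym; apply: contra_neq y0 => /rnorm_eq0.
rewrite -ler_sqr ?nnegrE ?mulr_ge0 ?rnorm_ge0// real_normK ?num_real// exprMn.
have := sqr_ge0 (rnorm (x + (- rdot x y / rnorm y ^+ 2)%:C *: y)).
rewrite expand -(pmulr_lge0 _ (exprn_gt0 2 ny0)).
suff -> : (rnorm x ^+ 2 + 2 * (- rdot x y / rnorm y ^+ 2) * rdot x y +
    (- rdot x y / rnorm y ^+ 2) ^+ 2 * rnorm y ^+ 2) * rnorm y ^+ 2 =
    rnorm x ^+ 2 * rnorm y ^+ 2 - rdot x y ^+ 2 by rewrite subr_ge0.
by field; rewrite gt_eqF.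
Qed.

Section Riesz.
Variables (phi : H -> R[i]) (M : R).
Hypothesis phiD : forall x y, phi (x + y) = phi x + phi y.
Hypothesis phiZ : forall a x, phi (a *: x) = a * phi x.
Hypothesis phi_le : forall x, `|complex.Re (phi x)| <= M * rnorm x.

Let J x := rnorm x ^+ 2 - 2 * complex.Re (phi x).

Let Re_phiZ t x : complex.Re (phi (t%:C *: x)) = t * complex.Re (phi x).
Proof. by rewrite phiZ; case: (phi x) => a b /=; rewrite mul0r subr0. Qed.

Let J_expand x y t : J (x + t%:C *: y) =
  J x + 2 * t * (rdot x y - complex.Re (phi y)) + t ^+ 2 * rnorm y ^+ 2.
Proof. rewrite /J expand phiD raddfD/= Re_phiZ; ring. Qed.

Let J_inf : has_inf (range J).
Proof.
split; first by exists (J 0), 0.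
exists (- M ^+ 2) => _ [x _ <-]; rewrite /J.
have := le_trans (ler_norm _) (phi_le x); have := sqr_ge0 (rnorm x - M); nra.
Qed.

Let d := inf (range J).

Let J_ge x : d <= J x.
Proof. by apply: (ge_inf J_inf.2); exists x. Qed.

Let J_mid x y : rnorm (x - y) ^+ 2 <= 2 * (J x - d) + 2 * (J y - d).
Proof.
have := J_expand y (x - y) 1; rewrite scale1r subrKC => Jx.
have := J_ge (y + 2^-1%:C *: (x - y)); rewrite J_expand.
set c := rdot _ _ - _ in Jx *; lra.
Qed.

Let F := filter_from [set e : R | 0 < e] (fun e => [set x | J x < d + e]).

Let F_proper : ProperFilter F.
Proof.
apply: filter_from_proper => [|e e0].
  apply: filter_from_filter; first by exists 1; rewrite /= ltr01.
  move=> e1 e2 /= e10 e20; exists (Num.min e1 e2); first by rewrite /= lt_min e10.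
  by move=> x /=; rewrite /= -!ltrBlDl lt_min => /andP[].
by have [_ [x _ <-] ?] := inf_adherent e0 J_inf; exists x.
Qed.

Let complex_gt0 (e : R[i]) : 0 < e -> 0 < complex.Re e /\ e = (complex.Re e)%:C.
Proof. by case: e => a b; rewrite ltcE/= => /andP[/eqP -> ->]. Qed.

Let F_cauchy : cauchy F.
Proof.
apply: (proj1 (@cauchy_ballP R[i] H F (@filter_filter _ _ F_proper))).
move=> ec /complex_gt0[e0 ->]; set e := complex.Re ec in e0 *.
pose D := [set x | J x < d + e ^+ 2 / 4].
have FD : F D by exists (e ^+ 2 / 4) => //=; rewrite divr_gt0 ?exprn_gt0.
exists (D, D) => // -[x y] /= [Dx Dy].
rewrite -ball_normE /= rnormE ltcR -ltr_sqr ?nnegrE ?rnorm_ge0 ?(ltW e0)//.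
move: Dx Dy; rewrite /D /=; have := J_mid x y; lra.
Qed.

Lemma riesz : exists z, forall x, phi x = inner x z.
Proof.
have /cvg_ex[z Fz] := @cauchy_cvg _ F F_proper F_cauchy.
have Rz v : complex.Re (phi v) = rdot v z.
  rewrite rdotC; apply/eqP; rewrite eq_sym -subr_eq0; set c := _ - _.
  have [//|c0] := eqVneq c 0.
  pose B := (1 + rnorm v ^+ 2) / 2 + rnorm v.
  have B0 : 0 < B.
    by rewrite /B; have := rnorm_ge0 v; have := sqr_ge0 (rnorm v); lra.
  pose s := `|c| / (2 * B).
  have s0 : 0 < s by rewrite divr_gt0 ?normr_gt0 ?mulr_gt0.
  have Fb : F (ball z s%:C) by apply: Fz; apply: nbhsx_ballx; rewrite ltcR.
  have FJ : F [set x | J x < d + s ^+ 2] by exists (s ^+ 2) => //=; rewrite exprn_gt0.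
  have [x [xz /= xJ]] := @filter_ex _ _ F_proper _ (@filterI _ _ (@filter_filter _ _ F_proper) _ _ Fb FJ).
  move: xz; rewrite -ball_normE /= rnormE ltcR => xz.
  have cx : `|rdot x v - complex.Re (phi v)| <= s * ((1 + rnorm v ^+ 2) / 2).
    have := J_ge (x + s%:C *: v); have := J_ge (x + (- s)%:C *: v).
    rewrite !J_expand; set cx := rdot x v - _ => h1 h2.
    rewrite ler_norml; apply/andP; split; rewrite -(ler_pM2l s0); nra.
  have : `|c| <= s * B.
    have -> : c = (rdot x v - complex.Re (phi v)) + rdot (z - x) v.
      rewrite /c; have := rdotDl (z - x) x v; rewrite subrK; lra.
    rewrite (le_trans (ler_normD _ _))// /B mulrDr lerD//.
    by rewrite (le_trans (rdot_le _ _))// ler_wpM2r ?rnorm_ge0// ltW.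
  have -> : s * B = `|c| / 2 by rewrite /s; field; rewrite gt_eqF.
  by move: c0; rewrite -normr_gt0; lra.
exists z => x; have := Rz x; have := Rz ('i *: x).
rewrite /rdot phiZ innerZl; case: (phi x) (inner x z) => a b [a' b'] /=.
by rewrite !mul0r !mul1r !sub0r => /oppr_inj -> ->.
Qed.

End Riesz.

Lemma adjoint_exists (T : bounded_linear H H) :
  exists S : bounded_linear H H, forall x y, inner (T x) y = inner x (S y).
Proof.
have ex y : exists z, forall x, inner (T x) y = inner x z.
  apply: (riesz (M := opnorm T * rnorm y)).
  - by move=> x x'; rewrite linearD innerDl.
  - by move=> a x; rewrite linearZ innerZl.
  - move=> x; rewrite (le_trans (rdot_le _ _))// mulrAC.
    by rewrite ler_wpM2r ?rnorm_ge0 ?opnormP.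
have [S ST] := choice ex.
have inner_inj u v : (forall x, inner x u = inner x v) -> u = v.
  move=> uv; apply/eqP; rewrite -subr_eq0; apply/eqP/rnorm_eq0/eqP.
  by rewrite -sqrf_eq0 -rdot_norm /rdot -scaleN1r innerDr innerZr uv
    rmorphN1 mulN1r subrr.
have Sp : S \in bounded_linear_pred (V := H) (W := H).
  apply/bounded_linear_predP; split.
    move=> a u v; apply: inner_inj => x.
    by rewrite -ST !innerDr !innerZr -!ST.
  exists (opnorm T) => y.
  have [->|] := eqVneq (rnorm (S y)) 0.
    by rewrite mulr_ge0 ?opnorm_ge0 ?rnorm_ge0.
  move=> n0; have {}n0 : 0 < rnorm (S y) by rewrite lt_neqAle eq_sym n0 rnorm_ge0.
  rewrite -(ler_pM2l n0) -expr2 -rdot_norm /rdot -ST.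
  rewrite (le_trans (ler_norm _))// (le_trans (rdot_le _ _))//.
  by rewrite mulrA ler_wpM2r ?rnorm_ge0// mulrC opnormP.
by exists (BoundedLinear Sp).
Qed.

Definition adjoint (T : bounded_linear H H) : bounded_linear H H :=
  projT1 (cid (adjoint_exists T)).

Lemma adjointP (T : bounded_linear H H) x y :
  inner (T x) y = inner x (adjoint T y).
Proof. by rewrite /adjoint; case: cid. Qed.

Lemma adjoint_uniq (T S : bounded_linear H H) :
  (forall x y, inner (T x) y = inner x (S y)) -> S = adjoint T.
Proof.
move=> TS; apply/val_inj/funext => y /=; apply/eqP; rewrite -subr_eq0.
apply/eqP/rnorm_eq0/eqP; rewrite -sqrf_eq0 -rdot_norm /rdot.
by rewrite -scaleN1r innerDr innerZr -TS -adjointP rmorphN1 mulN1r subrr.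
Qed.

Lemma adjointD (S T : bounded_linear H H) : adjoint (S + T) = adjoint S + adjoint T.
Proof.
apply/esym/adjoint_uniq => x y.
by rewrite !blDE innerDl !adjointP innerDr.
Qed.

Lemma adjointZ a (T : bounded_linear H H) : adjoint (a *: T) = a^* *: adjoint T.
Proof.
apply/esym/adjoint_uniq => x y.
by rewrite !blZE innerZl adjointP innerZr conjCK.
Qed.

Lemma opnorm_adjoint (T : bounded_linear H H) : opnorm (adjoint T) <= opnorm T.
Proof.
apply: opnorm_le => [|y]; first exact: opnorm_ge0.
have [->|] := eqVneq (rnorm (adjoint T y)) 0.
  by rewrite mulr_ge0 ?opnorm_ge0 ?rnorm_ge0.
move=> n0; have {}n0 : 0 < rnorm (adjoint T y).
  by rewrite lt_neqAle eq_sym n0 rnorm_ge0.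
rewrite -(ler_pM2l n0) -expr2 -rdot_norm /rdot -adjointP.
rewrite (le_trans (ler_norm _))// (le_trans (rdot_le _ _))//.
by rewrite mulrA ler_wpM2r ?rnorm_ge0// mulrC opnormP.
Qed.

End InnerProduct.

Record bounded_antilinear (R : realType) (V W : normedModType R[i]) :=
  BoundedAntilinear {
    ba_fun :> V -> W ;
    ba_antilinear : forall (a : R[i]) x y,
      ba_fun (a *: x + y) = a^* *: ba_fun x + ba_fun y ;
    ba_bounded : is_bounded ba_fun }.

Section GammaPhiMap.
Context {R : realType} {K : compactHausdorffType} {A : uniform_algebra R K}.
Context {H : hilbertType R}.
Local Notation L := (bounded_linear H H).
Local Notation A' := (bounded_linear (ua_elt A) R[i]^o).

Definition extremal_pair (gamma : bounded_linear (ua_elt A) L)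
    (f0 : ua_elt A) (x0 : H) :=
  [/\ rnorm f0 = 1, rnorm x0 = 1 & rnorm gamma = rnorm (gamma f0 x0)].

Section GammaPhi.
Variables (gamma : bounded_linear (ua_elt A) L).
Variable Phi : bounded_antilinear (ua_elt A) (ua_elt A).

Lemma gammaPhi_subproof :
  (fun f => gamma f + adjoint (gamma (Phi f))) \in
    bounded_linear_pred (V := ua_elt A) (W := L).
Proof.
apply/bounded_linear_predP; split=> [a f g|].
  rewrite ba_antilinear !linearP adjointD adjointZ conjCK.
  by rewrite scalerDr addrACA.
have [M PhiM] := ba_bounded Phi.
exists (opnorm gamma + opnorm gamma * M) => f.
rewrite (le_trans (rnormD _ _))// mulrDl lerD ?opnormP//.
rewrite (le_trans (opnorm_adjoint _))// (le_trans (opnormP gamma _))//.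
by rewrite -mulrA ler_wpM2l ?opnorm_ge0.
Qed.

Definition gammaPhi : bounded_linear (ua_elt A) L :=
  BoundedLinear gammaPhi_subproof.

End GammaPhi.

Lemma functional_op_subproof (omega : A') :
  (fun f => (omega f : R[i]) *: (1 : L)) \in
    bounded_linear_pred (V := ua_elt A) (W := L).
Proof.
apply/bounded_linear_predP; split=> [a f g|].
  have -> : omega (a *: f + g) = a * omega f + omega g :> R[i].
    by rewrite linearP.
  by rewrite scalerDl scalerA.
exists (opnorm omega * rnorm (1 : L)) => f.
rewrite rnormZ mulrAC ler_wpM2r ?rnorm_ge0//.
exact: (opnormP omega f).
Qed.

(* The canonical embedding of A' into the bounded linear maps A -> L(H). *)
Definition functional_op (omega : A') : bounded_linear (ua_elt A) L :=
  BoundedLinear (functional_op_subproof omega).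

End GammaPhiMap.

(* Main.v *)
Require Import Defs.
From HB Require Import structures.
From mathcomp Require Import all_boot all_order all_algebra sesquilinear.
From mathcomp Require Import complex.
From mathcomp Require Import boolp classical_sets functions filter reals.
From mathcomp Require Import topology normedtype.
From mathcomp Require Import ring lra.

Set Implicit Arguments.
Unset Strict Implicit.
Unset Printing Implicit Defensive.

Import Order.TTheory GRing.Theory Num.Theory.
Import numFieldNormedType.Exports.

Local Open Scope classical_set_scope.
Local Open Scope ring_scope.
Local Open Scope complex_scope.

(** Write N for the norm of gamma, T for gamma f0 and c for <T x0, x0>. The
    proof rests on the fact that c = 0 as soon as N > 1.

    Given c = 0, add and subtract omega: since T x0 equals
    (gammaPhi - omega)(f0) x0 + omega(f0) x0 - gamma(Phi f0)^* x0, pairing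
    with T x0 kills the omega(f0) term, and the adjoint term becomes the
    conjugate of <gamma(Phi f0 * f0) x0, x0>. By Cauchy-Schwarz,
    N^2 <= |gammaPhi - omega| N + k with k = |<gamma(Phi f0 * f0) x0, x0>|;
    taking the infimum d over omega gives N^2 <= d N + k, and completing the
    square gives the bound.

    To see that c = 0 ([extremal_orthogonal]), perturb f0 by Moebius maps of
    the disc. For small complex e, (f0 - e)/(1 - e^* f0) has norm at most 1;
    its expansion to first order, p = f0 - e + e^* f0^2, is a polynomial in
    f0 and still satisfies |p|^2 <= 1 + 4|e|^2 ([rnorm_moebius_approx]), so
    that no inverse in A has to be constructed. Hence
    |gamma(p) x0|^2 <= N^2 (1 + 4|e|^2). On the other hand T attains its
    norm N at x0, so T^* T x0 = N^2 x0 ([inner_norming]), whence the part of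
    |gamma(p) x0|^2 of first order in e is 2 (N^2 - 1) Re(e^* c). For e = t c
    this equals 2 (N^2 - 1) t |c|^2, which exceeds the error 4 N^2 t^2 |c|^2
    for small t > 0 unless c = 0. *)

Section ScalarLemmas.
Context {R : realType}.

(** The polynomial is (z - e) / (1 - e^* z) up to terms of order |e|^2, so
    only such an error can push it out of the unit disc. *)
Lemma moebius_approx_le (e z : R[i]) :
  complex.Re `|e| <= 2^-1 -> complex.Re `|z| <= 1 ->
  complex.Re `|z - e + e^* * z ^+ 2| ^+ 2 <= 1 + 4 * complex.Re `|e| ^+ 2.
Proof.
have nE (w : R[i]) : complex.Re `|w| ^+ 2 = complex.Re w ^+ 2 + complex.Im w ^+ 2.
  by rewrite normc_def /= sqr_sqrtr// addr_ge0 ?sqr_ge0.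
rewrite -[in X in X -> _ -> _]ler_sqr ?nnegrE ?cabs_ge0 ?invr_ge0//.
rewrite -[in X in _ -> X -> _]ler_sqr ?nnegrE ?cabs_ge0// expr1n.
rewrite !nE; case: e => u v; case: z => a b /= e_le z_le.
set q := a ^+ 2 + b ^+ 2 in z_le; set E := u ^+ 2 + v ^+ 2 in e_le *.
set s := u * a + v * b.
have s_le : s ^+ 2 <= E * q.
  by have := sqr_ge0 (u * b - v * a); rewrite /s /E /q; lra.
(* The squared modulus, in terms of q = |z|^2, E = |e|^2, s = Re (e^* z). *)
rewrite [leLHS](_ : _ = q - 2 * s * (1 - q) + E * (1 + q) ^+ 2 - 4 * s ^+ 2);
  last by rewrite /s /E /q; ring.
have q0 : 0 <= q by rewrite addr_ge0 ?sqr_ge0.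
have E0 : 0 <= E by rewrite addr_ge0 ?sqr_ge0.
(* The term of first order is absorbed by 1 - q: here |e| <= 1/2 is used. *)
have s_ge : - (2 * s) <= 1 by nra.
nra.
Qed.

Lemma Re_conj_ge (z : R[i]) : - complex.Re z^*%C <= complex.Re `|z|.
Proof.
case: z => a b; rewrite normc_def /= (le_trans (ler_norm _))// normrN -sqrtr_sqr.
by rewrite ler_wsqrtr// lerDl sqr_ge0.
Qed.

Lemma Re_norm_real (t : R) : complex.Re `|t%:C| = `|t|.
Proof. by rewrite normc_def /= expr0n addr0 sqrtr_sqr. Qed.

Lemma Re_mulCl (t : R) (a : R[i]) : complex.Re (t%:C * a) = t * complex.Re a.
Proof. by case: a => a b /=; rewrite mul0r subr0. Qed.

Lemma conjC_real (t : R) : (t%:C)^*%R = t%:C.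
Proof. by rewrite /Num.conj /= oppr0. Qed.

End ScalarLemmas.

Section HilbertLemmas.
Context {R : realType} {H : hilbertType R}.
Implicit Types (x y : H) (T : bounded_linear H H).

Lemma Re_innerC x y : complex.Re (inner x y) = complex.Re (inner y x).
Proof. by rewrite innerC; case: (inner y x). Qed.

Lemma sqr_rnorm x : rnorm x ^+ 2 = complex.Re (inner x x).
Proof. by rewrite inner_norm rnormE -rmorphXn. Qed.

Lemma sqr_rnormD x y :
  rnorm (x + y) ^+ 2 = rnorm x ^+ 2 + 2 * complex.Re (inner x y) + rnorm y ^+ 2.
Proof.
rewrite !sqr_rnorm innerDl !innerDr !raddfD/= (Re_innerC y x); ring.
Qed.

(** Cauchy-Schwarz for the real part, from the nonnegativity of
    | |y| x - |x| y |^2. *)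
Lemma Re_inner_le x y : complex.Re (inner x y) <= rnorm x * rnorm y.
Proof.
have [->|x0] := eqVneq x 0; first by rewrite linear0l rnorm0 mul0r.
have [->|y0] := eqVneq y 0; first by rewrite linear0r rnorm0 mulr0.
have pos (z : H) : z != 0 -> 0 < rnorm z.
  move=> z0; rewrite lt_neqAle rnorm_ge0 andbT eq_sym.
  by apply: contra_neq z0 => /rnorm_eq0.
have := sqr_ge0 (rnorm ((rnorm y)%:C *: x + (- rnorm x)%:C *: y)).
rewrite sqr_rnormD !rnormZ !Re_norm_real normrN !ger0_norm ?rnorm_ge0//.
rewrite innerZl innerZr conjC_real !Re_mulCl.
have := mulr_gt0 (pos _ x0) (pos _ y0); nra.
Qed.

(** A vector x at which T attains its norm is an eigenvector of T^* T. In
    |T^* T x - |T|^2 x|^2 the cross term is -2 |T|^2 |T x|^2 = -2 |T|^4 |x|^2,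
    while each of the two squares is at most |T|^4 |x|^2. *)
Lemma inner_norming T x : rnorm (T x) = opnorm T * rnorm x ->
  forall y, inner (T y) (T x) = (opnorm T ^+ 2)%:C * inner y x.
Proof.
move=> Tx y; set N := opnorm T in Tx *.
suff E : adjoint T (T x) = (N ^+ 2)%:C *: x.
  by rewrite adjointP E innerZr conjC_real.
apply/eqP; rewrite -subr_eq0 -scaleNr -rmorphN; apply/eqP/rnorm_eq0/eqP.
rewrite -sqrf_eq0 eq_le sqr_ge0 andbT sqr_rnormD rnormZ.
rewrite innerZr conjC_real Re_mulCl Re_innerC -adjointP -sqr_rnorm Tx.
rewrite Re_norm_real normrN ger0_norm ?sqr_ge0//.
have N0 : 0 <= N by exact: opnorm_ge0.
have : rnorm (adjoint T (T x)) <= N ^+ 2 * rnorm x.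
  rewrite (le_trans (opnormP _ _))// Tx mulrA expr2.
  by rewrite ler_wpM2r ?rnorm_ge0// ler_wpM2r// opnorm_adjoint.
rewrite -ler_sqr ?nnegrE ?mulr_ge0 ?sqr_ge0 ?rnorm_ge0// => adj_le.
set a := rnorm _ ^+ 2 in adj_le *; lra.
Qed.

End HilbertLemmas.

Section Extremal.
Context {R : realType} {K : compactHausdorffType} {A : uniform_algebra R K}.
Context {H : hilbertType R}.
Variable gamma : bounded_linear (ua_elt A) (bounded_linear H H).

Lemma rnorm_moebius_approx (f : ua_elt A) (e : R[i]) :
  rnorm f <= 1 -> complex.Re `|e| <= 2^-1 ->
  rnorm (f - e *: (1 : ua_elt A) + e^* *: (f * f)) ^+ 2 <=
    1 + 4 * complex.Re `|e| ^+ 2.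
Proof.
move=> f1 e2; set B := 1 + _.
have B0 : 0 <= B by rewrite addr_ge0// mulr_ge0// sqr_ge0.
rewrite -(sqr_sqrtr B0) ler_sqr ?nnegrE ?rnorm_ge0 ?sqrtr_ge0//.
apply: supnorm_le => [|t]; first exact: sqrtr_ge0.
rewrite -ler_sqr ?nnegrE ?rnorm_ge0 ?sqrtr_ge0// (sqr_sqrtr B0).
have := @moebius_approx_le R e (f t) e2 (le_trans (supnormP f t) f1).
by congr (complex.Re _ ^+ 2 <= _); rewrite expr2 -{1}(mulr1 e).
Qed.

Lemma opnorm_extremal (f0 : ua_elt A) (x0 : H) :
  extremal_pair gamma f0 x0 -> opnorm (gamma f0) = rnorm gamma.
Proof.
move=> [f1 x1 N]; apply/eqP; rewrite eq_le.
have := opnormP gamma f0; rewrite f1 mulr1 => -> /=.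
by have := opnormP (gamma f0) x0; rewrite x1 mulr1 -N.
Qed.

(** If c = <gamma(f0) x0, x0> were nonzero, moving f0 to
    f0 - e + e^* f0^2 in the direction e = t c would increase
    |gamma(f0) x0|^2 by at least 2 (|gamma|^2 - 1) t |c|^2, which for small t
    is more than the norm of gamma allows. *)
Lemma extremal_orthogonal (f0 : ua_elt A) (x0 : H) :
  GRing.monoid_morphism gamma -> 1 < rnorm gamma ->
  extremal_pair gamma f0 x0 -> inner (gamma f0 x0) x0 = 0.
Proof.
move=> gamma_hom gamma_gt1 extremal; have [f1 x1 Nx] := extremal.
have Tx y : inner (gamma f0 y) (gamma f0 x0) =
    (rnorm gamma ^+ 2)%:C * inner y x0.
  have TN := opnorm_extremal extremal.
  by rewrite -TN inner_norming// x1 mulr1 TN.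
set N := rnorm gamma in gamma_gt1 Nx Tx.
set c := inner _ _; apply/eqP; apply: contraT => c0.
have r0 := cabs_gt0 c0; set r := complex.Re `|c| in r0.
(* The first bound gives |e| <= 1/2; with the second, the error
   4 N^2 t^2 r^2 is at most (N^2 - 1) t r^2, half the gain. *)
pose t := Num.min ((2 * r)^-1) ((N ^+ 2 - 1) / (4 * N ^+ 2)).
have N0 : 0 < N by rewrite (lt_trans _ gamma_gt1).
have t0 : 0 < t.
  rewrite lt_min invr_gt0 mulr_gt0// divr_gt0 ?mulr_gt0 ?exprn_gt0//.
  by rewrite subr_gt0 exprn_egt1.
have tr : t * r <= 2^-1.
  by rewrite -ler_pdivlMr// -invfM ge_min lexx.
have tN : t * (4 * N ^+ 2) <= N ^+ 2 - 1.
  by rewrite -ler_pdivlMr ?mulr_gt0 ?exprn_gt0// ge_min lexx orbT.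
pose e := t%:C * c.
have eE : complex.Re `|e| = t * r.
  by rewrite normrM cabsE -rmorphM Re_norm_real gtr0_norm.
have f0_le1 : rnorm f0 <= 1 by rewrite f1.
have e2 : complex.Re `|e| <= 2^-1 by rewrite eE.
have := rnorm_moebius_approx f0_le1 e2.
set p := _ + _ => p_le.
pose w := - (e *: x0) + e^* *: gamma f0 (gamma f0 x0).
have gp : gamma p x0 = gamma f0 x0 + w.
  rewrite linearD linearB !linearZ /= gamma_hom.1 !gamma_hom.2.
  by rewrite [RHS]addrA -scalerN.
have gp_le : rnorm (gamma p x0) ^+ 2 <= N ^+ 2 * (1 + 4 * (t * r) ^+ 2).
  rewrite -eE (le_trans _ (ler_wpM2l (sqr_ge0 N) p_le))// -exprMn.
  rewrite ler_sqr ?nnegrE ?mulr_ge0 ?rnorm_ge0//.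
  rewrite (le_trans (opnormP _ _))// x1 mulr1; exact: (opnormP gamma).
have wE : complex.Re (inner (gamma f0 x0) w) = (N ^+ 2 - 1) * t * r ^+ 2.
  rewrite Re_innerC /w -scaleNr innerDl !innerZl Tx [inner x0 _]innerC -/c.
  rewrite /r normc_def /= sqr_sqrtr ?addr_ge0 ?sqr_ge0//.
  rewrite /e /Num.conj /=; case: (c) => a b /=; ring.
move: gp_le; rewrite gp sqr_rnormD -Nx wE.
have := sqr_ge0 (rnorm w).
have tr2 := mulr_gt0 t0 (exprn_gt0 2 r0).
have N1 : 0 < N ^+ 2 - 1 by rewrite subr_gt0 exprn_egt1.
have := ler_wpM2r (ltW tr2) tN; have := mulr_gt0 N1 tr2; lra.
Qed.

End Extremal.

Theorem theorem5 (R : realType) (K : compactHausdorffType)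
    (A : uniform_algebra R K) (H : hilbertType R)
    (gamma : bounded_linear (ua_elt A) (bounded_linear H H))
    (gamma_hom : GRing.monoid_morphism gamma)
    (Phi : bounded_antilinear (ua_elt A) (ua_elt A))
    (gamma_gt1 : 1 < rnorm gamma)
    (f0 : ua_elt A) (x0 : H) (extremal : extremal_pair gamma f0 x0) :
  let d : R := inf [set rnorm (gammaPhi gamma Phi - functional_op (H := H) omega)
                   | omega in [set: bounded_linear (ua_elt A) R[i]^o]] in
  rnorm gamma <=
    2^-1 * d +
    Num.sqrt ((2^-1 * d) ^+ 2 +
              rnorm (inner (gamma (Phi f0 * f0) x0) x0 : R[i]^o)).
Proof.
cbv zeta; set d := inf _.
have [f1 x1 Nx] := extremal.
have c0 := extremal_orthogonal gamma_hom gamma_gt1 extremal.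
set N := rnorm gamma in gamma_gt1 Nx *; set k := rnorm (inner _ _ : R[i]^o).
have N0 : 0 < N by rewrite (lt_trans _ gamma_gt1).
have key (omega : bounded_linear (ua_elt A) R[i]^o) :
    N ^+ 2 <= rnorm (gammaPhi gamma Phi - functional_op (H := H) omega) * N + k.
  set D := gammaPhi _ _ - _.
  (* The term omega(f0) x0 will be orthogonal to gamma(f0) x0. *)
  have E : gamma f0 x0 =
      D f0 x0 + (omega f0 : R[i]) *: x0 - adjoint (gamma (Phi f0)) x0.
    rewrite [D f0 x0](_ : _ = gamma f0 x0 + adjoint (gamma (Phi f0)) x0
      - (omega f0 : R[i]) *: x0) //.
    by rewrite subrK addrK.
  have SE : inner (adjoint (gamma (Phi f0)) x0) (gamma f0 x0) =
      (inner (gamma (Phi f0 * f0) x0) x0)^*.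
    by rewrite innerC -adjointP gamma_hom.2.
  rewrite {1}Nx sqr_rnorm {1}E innerDl innerDl -scaleN1r !innerZl.
  rewrite [inner x0 _]innerC c0 SE.
  rewrite (_ : (0 : R[i])^*%C = 0) ?mulr0 ?addr0; last by rewrite conjc0.
  rewrite mulN1r raddfB /= lerD//; last exact: Re_conj_ge.
  rewrite (le_trans (Re_inner_le _ _))// -Nx ler_wpM2r ?(ltW N0)//.
  have := opnormP (D f0) x0; rewrite x1 mulr1 => /le_trans -> //.
  by have := opnormP D f0; rewrite f1 mulr1.
have d_ge : (N ^+ 2 - k) / N <= d.
  apply: lb_le_inf; first by eexists; exists 0.
  by move=> _ [omega _ <-]; rewrite ler_pdivrMr// lerBlDr key.
have {}d_ge : N ^+ 2 <= d * N + k by rewrite -lerBlDr -ler_pdivrMr.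
(* d N + k >= N^2 says (N - d/2)^2 <= (d/2)^2 + k. *)
rewrite -lerBlDl (le_trans (ler_norm _))// -sqrtr_sqr ler_wsqrtr//; lra.
Qed.
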